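(* Let $X=Y\subset\mathbb R^d$, $d\in\{1,2,3\}$, be $n$ uniformly distributed points and let $\mathcal T$ be the associated perfect $2^d$-tree with $L$ levels, where $n$ is of the order of $r2^{dL}$ for a positive integer $r$. Suppose the rank of the $\mathcal H^2$ generators is at most $r$ and that $|\bar{\mathbf i}^{row}|\le r2^d$ and $|\bar{\mathbf i}^{col}|\le r2^d$ for every nonroot node $i$. Then the complexity of the SMASH $\mathcal H^2$ construction (described in the context) is $O(n)$, with $r$ and $d$ regarded as constants.
   Context: Problem. Given $A=[\kappa(x,y)]_{x\in X,y\in Y}$ of order $n$ (entries computable at unit cost) and a perfect $2^d$-tree $\mathcal T$ with $L$ levels (root at level $1$, leaves at level $L$) of cubes $\Omega_i$ (the children of a cube are its $2^d$ congruent subcubes), construct an $\mathcal H^2$ approximation of $A$. $\mathbf i^{row}$, $\mathbf i^{col}$ are the indices of points of $X$, $Y$ in $\Omega_i$; the tree and these index sets for leaves are given. A pair $(i,j)$ of nodes is admissible if $\Omega_i,\Omega_j$ are well-separated, i.e. $\delta_i+\delta_j\le\tau|a_i-a_j|$ for the centers $a$ and radii $\delta$ of their smallest enclosing balls, with $\tau\in(0,1)$ fixed. Compression routine. For $M$ with rows indexed by $\mathbf k$, $[P,G,\hat{\mathbf k}]=\mathrm{compr}(M,\mathbf k)$ (strong rank-revealing QR of $M^T$ with fixed parameter $s>1$) returns $\hat{\mathbf k}\subseteq\mathbf k$, a permutation matrix $P$ and a matrix $G$ with entries bounded by $s$ such that $M=P\begin{bmatrix} I \\ G \end{bmatrix}M|_{\hat{\mathbf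 k}}$. Construction. For a leaf $i$, $\bar{\mathbf i}^{row}=\mathbf i^{row}$, $\bar{\mathbf i}^{col}=\mathbf i^{col}$. For $l=L,L-1,\dots,2$ and each node $i$ at level $l$: form farfield basis matrices $\hat U_i,\hat V_i$ with rows indexed by $\bar{\mathbf i}^{row},\bar{\mathbf i}^{col}$ and at most $r$ columns, by evaluating explicit functions (e.g. Taylor or interpolation basis functions) at the points, at unit cost per entry; then compute $[P_i,G_i,\hat{\mathbf i}^{row}]=\mathrm{compr}(\hat U_i,\bar{\mathbf i}^{row})$ and $[F_i,H_i,\hat{\mathbf i}^{col}]=\mathrm{compr}(\hat V_i,\bar{\mathbf i}^{col})$. For a parent $p$, $\bar{\mathbf p}^{row}$ (resp. $\bar{\mathbf p}^{col}$) is the union of $\hat{\mathbf c}^{row}$ (resp. $\hat{\mathbf c}^{col}$) over its children $c$. The matrices $P_i\begin{bmatrix} I \\ G_i \end{bmatrix}$, $F_i\begin{bmatrix} I \\ H_i \end{bmatrix}$ are the basis generators (leaf $i$) or stacked transfer generators of the children (nonleaf $i$). The coupling blocks $A|_{\hat{\mathbf i}^{row}\times\hat{\mathbf j}^{col}}$ (for same-level admissible $(i,j)$ whose parents are not admissible) and the nearfield blocks $A|_{\mathbf i^{row}\times\mathbf j^{col}}$ (for non-admissible pairs of leaves) are submatrices of $A$ and are represented by their index sets. Cost model. Complexity is the number of arithmetic operations and kernel evaluations. The strong rank-revealing QR of a matrix both of whose dimensions are bounded by a fixed multiple of $r$ is taken to cost $O(r^3)$ operations (with $s$, $d$ fixed).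 *)

(* Defs.v *)
From HB Require Import structures.
From mathcomp Require Import all_boot all_order all_algebra all_fingroup.
From mathcomp Require Import boolp classical_sets reals.

Set Implicit Arguments.
Unset Strict Implicit.
Unset Printing Implicit Defensive.

Import Order.TTheory GRing.Theory Num.Theory.
Local Open Scope ring_scope.

Section Geometry.
Local Open Scope classical_set_scope.
Variables (R : realType) (d : nat).

(* The norm that 'rV[R]_d carries in the library is the sup norm. *)
Definition enorm (v : 'rV[R]_d) : R := Num.sqrt (\sum_i v 0 i ^+ 2).

Definition enclosing_ball (Omega : set 'rV[R]_d) (a : 'rV[R]_d) (delta : R) :=
  Omega `<=` [set x : 'rV[R]_d | enorm (x - a) <= delta].

Definition smallest_enclosing_ball
    (Omega : set 'rV[R]_d) (a : 'rV[R]_d) (delta : R) :=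
  enclosing_ball Omega a delta /\
  forall b eps, enclosing_ball Omega b eps -> delta <= eps.

Definition well_separated (tau : R) (Omega Omega' : set 'rV[R]_d) :=
  exists a delta a' delta',
    [/\ smallest_enclosing_ball Omega a delta,
        smallest_enclosing_ball Omega' a' delta'
      & delta + delta' <= tau * enorm (a - a')].

Record cube := Cube { corner : 'rV[R]_d; side : R }.

Definition cube_set (c : cube) : set 'rV[R]_d :=
  [set x : 'rV[R]_d | forall k, corner c 0 k <= x 0 k <= corner c 0 k + side c].

(* One of the 2^d children: upper half along coordinate k iff b k. *)
Definition octant := {ffun 'I_d -> bool}.

Definition subcube (b : octant) (c : cube) : cube :=
  Cube (\row_k (corner c 0 k + (b k)%:R * (side c / 2))) (side c / 2).

(* A node is its path to the root, its own octant first: [::] is the root, *)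
(* the children of p are the b :: p, the parent of p is behead p, and p is  *)
(* at level (size p).+1.                                                    *)
Definition node := seq octant.

Definition node_cube (root : cube) (p : node) : cube := foldr subcube root p.

End Geometry.

Section Compression.
Variable K : numFieldType.

(* Matrices whose rows are indexed by k : {set T} are 'M_(#|k|, m), row a  *)
(* standing for the index enum_val a.                                      *)
Record compression (T : finType) (k : {set T}) := Compression {
  skel : {set T};
  skel_sub : skel \subset k;
  cperm : 'S_#|k|;
  cmx : 'M[K]_(#|k| - #|skel|, #|skel|)
}.

(* P [I; G] *)
Definition generator (T : finType) (k : {set T}) (c : compression k) :
    'M[K]_(#|k|, #|skel c|) :=
  perm_mx (cperm c) *m
  castmx (subnKC (subset_leq_card (skel_sub c)), erefl)
    (col_mx 1%:M (cmx c)).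

Definition restrict_rows (T : finType) (j k : {set T}) (jk : j \subset k)
    (m : nat) (M : 'M[K]_(#|k|, m)) : 'M[K]_(#|j|, m) :=
  rowsub (fun a => enum_rank_in (fintype.subsetP jk _ (enum_valP a)) (enum_val a)) M.

(* The result, together with the number of operations spent. *)
Definition compression_routine :=
  forall (T : finType) (k : {set T}) (m : nat),
    'M[K]_(#|k|, m) -> compression k * nat.

Definition compr_correct (s : K) (compr : compression_routine) :=
  forall (T : finType) (k : {set T}) (m : nat) (M : 'M[K]_(#|k|, m)),
    let c := (compr T k m M).1 in
    (forall a b, `|cmx c a b| <= s) /\
    M = generator c *m restrict_rows (skel_sub c) M.

(* O(r^3) operations when both dimensions are at most a multiple of r. *)
Definition compr_cubic (compr : compression_routine) :=
  forall c : nat, exists C : nat,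
  forall (r : nat) (T : finType) (k : {set T}) (m : nat) (M : 'M[K]_(#|k|, m)),
    (0 < r)%N -> (#|k| <= c * r)%N -> (m <= c * r)%N ->
    ((compr T k m M).2 <= C * r ^ 3)%N.

End Compression.

Section Problem.
Variables (R : realType) (K : numFieldType) (d : nat).

Record basis := Basis {
  bsize : nat;
  bfun : 'I_bsize -> 'rV[R]_d -> K
}.

(* The set of points is X = Y. Cubes are closed, so a point on a common    *)
(* face is assigned by leaf_of to a single one of the leaves containing it. *)
Record problem := Problem {
  npts : nat;
  pts : 'I_npts -> 'rV[R]_d;
  pts_inj : injective pts;
  kernel : 'rV[R]_d -> 'rV[R]_d -> K;
  levels : nat;
  levels_gt0 : (0 < levels)%N;
  root_cube : cube R d;
  root_side_gt0 : 0 < side root_cube;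
  leaf_of : 'I_npts -> (levels.-1).-tuple (octant d);
  leaf_ofP : forall i, cube_set (node_cube root_cube (leaf_of i)) (pts i);
  row_basis : node d -> basis;
  col_basis : node d -> basis
}.

Definition kernel_matrix (Q : problem) : 'M[K]_(npts Q) :=
  \matrix_(i, j) kernel Q (pts i) (pts j).

Definition leaf_set (Q : problem) (p : node d) : {set 'I_(npts Q)} :=
  [set i | tval (leaf_of i) == p].

(* Every leaf holds, up to the factor rho, the average number of points. *)
Definition uniformly_distributed (rho : nat) (Q : problem) :=
  forall p : (levels Q).-1.-tuple (octant d),
    (npts Q <= rho * (2 ^ (d * (levels Q).-1) * #|leaf_set Q p|))%N /\
    (2 ^ (d * (levels Q).-1) * #|leaf_set Q p| <= rho * npts Q)%N.

Definition admissible (tau : R) (Q : problem) (p q : node d) : bool :=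
  `[< well_separated tau (cube_set (node_cube (root_cube Q) p))
                         (cube_set (node_cube (root_cube Q) q)) >].

End Problem.

Section Construction.
Variables (R : realType) (K : numFieldType) (d : nat).
Variables (compr : compression_routine K) (tau : R) (test_cost : nat).
Variable Q : problem R K d.
Local Notation n := (npts Q).
Local Notation L := (levels Q).

Definition farfield (k : {set 'I_n}) (B : basis R K d) :
    'M[K]_(#|k|, bsize B) * nat :=
  (\matrix_(a, b) bfun b (pts (enum_val a)), (#|k| * bsize B)%N).

Definition compress (k : {set 'I_n}) (B : basis R K d) :
    compression K k * nat :=
  let: (M, evals) := farfield k B in
  let: (c, ops) := compr M in (c, (evals + ops)%N).

Section OneSide.
(* row_basis or col_basis *)
Variable B : node d -> basis R K d.

(* h is the height of the node p above the leaves. *)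
Fixpoint bar_rec (h : nat) (p : node d) : {set 'I_n} :=
  if h is h'.+1 then
    \bigcup_(b : octant d) skel (compress (bar_rec h' (b :: p)) (B (b :: p))).1
  else leaf_set Q p.

Definition bar (p : node d) : {set 'I_n} := bar_rec (L.-1 - size p) p.

Definition node_compr (p : node d) : compression K (bar p) * nat :=
  compress (bar p) (B p).

Definition hat (p : node d) : {set 'I_n} := skel (node_compr p).1.

Definition side_cost : nat :=
  \sum_(1 <= l < L) \sum_(p : l.-tuple (octant d)) (node_compr p).2.

End OneSide.

(* The pairs at depth l whose parents are not admissible; (root, root) is   *)
(* among them because it is its own (never admissible) pair of parents. By  *)
(* descending the tree these are the only pairs whose admissibility has to  *)
(* be tested, at test_cost operations each.                                 *)
Definition tested (l : nat) : {set l.-tuple (octant d) * l.-tuple (octant d)} :=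
  [set pq : l.-tuple (octant d) * l.-tuple (octant d) |
    ~~ admissible tau Q (behead pq.1) (behead pq.2)].

Definition coupling_pairs (l : nat) :
    {set l.-tuple (octant d) * l.-tuple (octant d)} :=
  [set pq : l.-tuple (octant d) * l.-tuple (octant d) in tested l | admissible tau Q pq.1 pq.2].

Definition nearfield_pairs :
    {set L.-1.-tuple (octant d) * L.-1.-tuple (octant d)} :=
  [set pq : L.-1.-tuple (octant d) * L.-1.-tuple (octant d) |
    ~~ admissible tau Q pq.1 pq.2].

(* The pair (I, J) represents the submatrix A|_(I x J) of kernel_matrix Q; *)
(* none of its entries is evaluated.                                        *)
Definition block := ({set 'I_n} * {set 'I_n})%type.

Definition block_matrix (IJ : block) : 'M[K]_(#|IJ.1|, #|IJ.2|) :=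
  mxsub enum_val enum_val (kernel_matrix Q).

(* Generators are meaningful at nonroot nodes only. *)
Record h2_representation := H2Representation {
  row_compr : forall p : node d, compression K (bar (@row_basis R K d Q) p);
  col_compr : forall p : node d, compression K (bar (@col_basis R K d Q) p);
  coupling : seq block;
  nearfield : seq block
}.

Definition smash_representation : h2_representation :=
  H2Representation
    (fun p => (node_compr (@row_basis R K d Q) p).1)
    (fun p => (node_compr (@col_basis R K d Q) p).1)
    (flatten
      [seq [seq (hat (@row_basis R K d Q) pq.1, hat (@col_basis R K d Q) pq.2)
           | pq : l.-tuple (octant d) * l.-tuple (octant d)
               <- enum (coupling_pairs l)] | l <- iota 0 L])
    [seq (leaf_set Q pq.1, leaf_set Q pq.2)
    | pq : L.-1.-tuple (octant d) * L.-1.-tuple (octant d)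
        <- enum nearfield_pairs].

Definition smash : h2_representation * nat :=
  (smash_representation,
   side_cost (@row_basis R K d Q) + side_cost (@col_basis R K d Q) +
   test_cost * \sum_(0 <= l < L) #|tested l|)%N.

End Construction.

(* Main.v *)
Require Import Defs.
From mathcomp Require Import all_boot all_order all_algebra.
From mathcomp Require Import boolp classical_sets reals.
From mathcomp Require Import zify ring lra.

(** A level [l] has [2 ^ (d l)] nodes, so a cost bounded by a constant at each
    node adds up, over all the levels, to a multiple of [2 ^ (d L) <= c1 n].
    This covers the compressions. For the admissibility tests, identify the
    nodes of a level with their integer positions in a cubic grid. Two cubes of
    side [h] whose positions differ by more than [sqrt d / tau] along some
    coordinate are well-separated, because the smallest enclosing ball of a cube
    is centred at its centre and has radius [sqrt d * h / 2]. Hence each node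
    lies in boundedly many tested pairs of its level. *)

Set Implicit Arguments.
Unset Strict Implicit.
Unset Printing Implicit Defensive.

Import Order.TTheory GRing.Theory Num.Theory.
Local Open Scope ring_scope.

Section CubeGeometry.
Variables (R : realType) (d : nat).
Implicit Types (c : cube R d) (p q : node d).

Definition cube_center c : 'rV[R]_d := \row_k (corner c 0 k + side c / 2).

Lemma coord_le_enorm (v : 'rV[R]_d) k : `|v 0 k| <= enorm v.
Proof.
rewrite /enorm -sqrtr_sqr ler_wsqrtr // (bigD1 k) //= lerDl.
by apply: sumr_ge0 => i _; exact: sqr_ge0.
Qed.

(** The radius is the half-diagonal. Each coordinate of a point of the cube is within half a side of
    the centre, which gives the enclosure. *)
Lemma cube_smallest_enclosing_ball c : 0 <= side c ->
  smallest_enclosing_ball (cube_set c) (cube_center c)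
    (Num.sqrt d%:R * (side c / 2)).
Proof.
move=> c0; set h := side c / 2; have h0 : 0 <= h by rewrite divr_ge0.
have side_hh : side c = h + h by exact: splitr.
have sumh : \sum_(i < d) h ^+ 2 = d%:R * h ^+ 2.
  by rewrite sumr_const card_ord mulr_natl.
split=> [x /= cx|b e cb].
  rewrite -[h in leRHS](ger0_norm h0) -sqrtr_sqr -sqrtrM ?ler0n //.
  rewrite ler_wsqrtr // -sumh; apply: ler_sum => k _.
  rewrite !mxE; have /andP[] := cx k; rewrite -/h side_hh.
  by move=> ? ?; nra.
have lo : cube_set c (corner c) by move=> k; rewrite lexx lerDl.
have e0 : 0 <= e by have := cb _ lo; apply: le_trans; exact: sqrtr_ge0.
have sq x : cube_set c x -> \sum_k (x 0 k - b 0 k) ^+ 2 <= e ^+ 2.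
  move=> /cb; rewrite /= /enorm => xe.
  have S0 : 0 <= \sum_k ((x - b) 0 k) ^+ 2.
    by apply: sumr_ge0 => k _; exact: sqr_ge0.
  have -> : \sum_k (x 0 k - b 0 k) ^+ 2 = \sum_k ((x - b) 0 k) ^+ 2.
    by apply: eq_bigr => k _; rewrite !mxE.
  by rewrite -(sqr_sqrtr S0) lerXn2r ?nnegrE ?sqrtr_ge0.
have hi : cube_set c (\row_k (corner c 0 k + side c)).
  by move=> k; rewrite mxE lexx lerDl c0.
(* The two opposite corners already force the radius. *)
have : d%:R * h ^+ 2 + d%:R * h ^+ 2 <= e ^+ 2 + e ^+ 2.
  apply: le_trans (lerD (sq _ lo) (sq _ hi)).
  rewrite -sumh -!big_split; apply: ler_sum => k _ /=.
  rewrite mxE side_hh.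
  (* With [t = corner c 0 k + h - b 0 k], the left corner contributes [(t - h)^2] and the right one
     [(t + h)^2], in all [2 t^2 + 2 h^2]. *)
  by have := sqr_ge0 (corner c 0 k + h - b 0 k); nra.
move=> dh; rewrite -[h](ger0_norm h0) -sqrtr_sqr -sqrtrM ?ler0n //.
by rewrite -(ger0_norm e0) -sqrtr_sqr ler_wsqrtr //; lra.
Qed.

Lemma side_node_cube root p :
  side (node_cube root p) = side root / 2 ^+ size p :> R.
Proof.
by elim: p => [|b p IH] /=; rewrite ?divr1 // IH exprSr invfM mulrA.
Qed.

(** A path starts with the node's own octant, so its head is the least significant binary digit. *)
Definition grid_index (k : 'I_d) p : nat :=
  foldr (fun (b : octant d) i => (b k + i.*2)%N) 0%N p.

Lemma corner_node_cube root p k :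
  corner (node_cube root p) 0 k =
    corner root 0 k + (grid_index k p)%:R * (side root / 2 ^+ size p) :> R.
Proof.
elim: p => [|b p IH] /=; first by rewrite mul0r addr0.
rewrite mxE IH side_node_cube -addrA; congr (_ + _).
rewrite natrD -muln2 natrM exprSr invfM; field.
by rewrite expf_neq0 // pnatr_eq0.
Qed.

(** Parities recover the head octant, and halving passes to the parent. Equal sizes are required
    since leading zeros do not show in the index. *)
Lemma grid_index_inj p q : size p = size q ->
  (forall k, grid_index k p = grid_index k q) -> p = q.
Proof.
elim: p q => [|b p IH] [|b' q] //= [sz] E; congr (_ :: _).
  apply/ffunP => k; have /(congr1 odd) := E k.
  by rewrite !oddD !odd_double !addbF !oddb.
apply: IH => // k; have /(congr1 half) := E k.
by rewrite !half_bit_double.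
Qed.

End CubeGeometry.

Section AdmissibilityTests.
Variables (R : realType) (K : numFieldType) (d : nat) (tau : R) (N : nat).
Hypotheses (tau_gt0 : 0 < tau) (N_ge : Num.sqrt d%:R / tau <= N%:R).
Variable Q : problem R K d.

Lemma nonadmissible_close p q : size p = size q -> ~~ admissible tau Q p q ->
  forall k : 'I_d, (grid_index k p <= grid_index k q + N)%N
                /\ (grid_index k q <= grid_index k p + N)%N.
Proof.
move=> sz /asboolPn nadm k.
set h := side (root_cube Q) / 2 ^+ size p.
have h0 : 0 < h by rewrite divr_gt0 ?exprn_gt0 ?root_side_gt0.
have side_p : side (node_cube (root_cube Q) p) = h by rewrite side_node_cube.
have side_q : side (node_cube (root_cube Q) q) = h.
  by rewrite side_node_cube -sz.
set cp := cube_center (node_cube (root_cube Q) p).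
set cq := cube_center (node_cube (root_cube Q) q).
have dist : `|(grid_index k p)%:R - (grid_index k q)%:R| * h <= enorm (cp - cq).
  apply: le_trans (coord_le_enorm _ k).
  rewrite !mxE side_p side_q !corner_node_cube -sz -/h -{1}(gtr0_norm h0).
  by rewrite -normrM le_eqVlt; apply/orP; left; apply/eqP; congr `|_|; ring.
have near : tau * enorm (cp - cq) < Num.sqrt d%:R * h.
  rewrite ltNge; apply/negP => far; apply: nadm.
  exists cp, (Num.sqrt d%:R * (h / 2)), cq, (Num.sqrt d%:R * (h / 2)); split.
  - by rewrite -side_p; apply: cube_smallest_enclosing_ball; rewrite side_p ltW.
  - by rewrite -side_q; apply: cube_smallest_enclosing_ball; rewrite side_q ltW.
  - by rewrite -mulrDr -splitr.
have : `|(grid_index k p)%:R - (grid_index k q)%:R| <= N%:R :> R.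
  apply: le_trans N_ge; rewrite ler_pdivlMr // -(ler_pM2r h0) ltW //.
  by apply: le_lt_trans near; rewrite mulrAC mulrC ler_pM2l.
rewrite ler_norml => /andP[? ?].
by split; rewrite -(ler_nat R) natrD; lra.
Qed.

(** The parents are non-admissible, so their indices differ by at most [N]; going down one level
    doubles this and the new digits add at most 1. *)
Lemma tested_close l (p q : l.-tuple (octant d)) : (p, q) \in tested tau Q l ->
  forall k : 'I_d, (grid_index k p <= grid_index k q + N.*2.+1)%N
                /\ (grid_index k q <= grid_index k p + N.*2.+1)%N.
Proof.
rewrite inE /= => /nonadmissible_close close k.
have := close _ k; rewrite !size_behead !size_tuple => /(_ erefl).
(* The empty path is included: the root is its own [behead], with index 0. *)
have grid_behead (t : node d) :
    (grid_index k t <= (grid_index k (behead t)).*2.+1)%N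
    /\ ((grid_index k (behead t)).*2 <= grid_index k t)%N.
  by case: t => [|b t] //=; case: (b k) => /=; lia.
by have := grid_behead p; have := grid_behead q; lia.
Qed.

Lemma card_tested l :
  (#|tested tau Q l| <= (2 ^ d) ^ l * (N.*2.+1.*2.+1 ^ d))%N.
Proof.
pose M := N.*2.+1.
(* A tested pair is encoded by its first node and the relative position of the second, shifted by
   [M] to lie in [0..2M]. *)
pose offset (pq : l.-tuple (octant d) * l.-tuple (octant d)) :=
  (pq.1, [ffun k : 'I_d =>
    inord (grid_index k pq.2 + M - grid_index k pq.1) : 'I_M.*2.+1]).
have offset_inj : {in tested tau Q l &, injective offset}.
  move=> [p q] [p' q'] tpq tpq' [pp' E]; rewrite -{p'}pp' in tpq' E *.
  congr (_, _); apply/val_inj/grid_index_inj => [|k]; first by rewrite !size_tuple.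
  have := congr1 (fun f : {ffun 'I_d -> 'I_M.*2.+1} => val (f k)) E.
  rewrite /= !ffunE.
  have := tested_close tpq k; have := tested_close tpq' k.
  (* Closeness ensures that the subtraction is not truncated and that [inord] does not fall back on
     its default. *)
  by rewrite -/M => ? ?; rewrite !inordK; lia.
rewrite -(card_in_imset offset_inj) (leq_trans (max_card _)) //.
by rewrite card_prod card_tuple !card_ffun !card_ord card_bool.
Qed.

End AdmissibilityTests.

(** Induction on [n]: the sum of the earlier terms and the new term are each at most [D ^ n], and
    [2 * D ^ n <= D ^ n.+1]. *)
Lemma leq_sum_expn (D m n : nat) : (1 < D)%N ->
  (\sum_(m <= l < n) D ^ l <= D ^ n)%N.
Proof.
move=> D1; elim: n => [|n IH]; first by rewrite big_geq.
have [lemn|ltnm] := leqP m n; last by rewrite big_geq.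
rewrite big_nat_recr //= (leq_trans (leq_add IH (leqnn _))) //.
by rewrite addnn -mul2n expnS leq_mul2r D1 orbT.
Qed.

Lemma side_cost_le (R : realType) (K : numFieldType) (d : nat)
    (compr : compression_routine K) (Q : problem R K d)
    (B : node d -> basis R K d) (E : nat) : (0 < d)%N ->
  (forall p : node d, (0 < size p < levels Q)%N ->
    ((node_compr compr Q B p).2 <= E)%N) ->
  (side_cost compr Q B <= (2 ^ d) ^ levels Q * E)%N.
Proof.
move=> d0 costE.
apply: (@leq_trans (\sum_(1 <= l < levels Q) (2 ^ d) ^ l * E)).
  rewrite /side_cost big_nat_cond [leqRHS]big_nat_cond.
  apply: leq_sum => l /andP[lL _].
  have -> : ((2 ^ d) ^ l * E = \sum_(p : l.-tuple (octant d)) E)%N.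
    by rewrite sum_nat_const card_tuple card_ffun card_bool card_ord.
  by apply: leq_sum => p _; apply: costE; rewrite size_tuple.
by rewrite -big_distrl leq_mul2r leq_sum_expn ?orbT // (leq_exp2l 1).
Qed.

Theorem theorem5p2 (R : realType) (K : numFieldType)
    (d : nat) (hd : (1 <= d <= 3)%N)
    (r : nat) (hr : (0 < r)%N)
    (tau : R) (htau : 0 < tau < 1)
    (s : K) (hs : 1 < s)
    (compr : compression_routine K)
    (hcompr : compr_correct s compr)
    (hcost : compr_cubic compr)
    (test_cost : nat) (c1 c2 rho : nat) :
  exists C : nat, forall Q : problem R K d,
    uniformly_distributed rho Q ->
    (r * 2 ^ (d * levels Q) <= c1 * npts Q)%N ->
    (npts Q <= c2 * (r * 2 ^ (d * levels Q)))%N ->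
    (forall p : node d, (0 < size p < levels Q)%N ->
      (bsize (row_basis Q p) <= r)%N /\ (bsize (col_basis Q p) <= r)%N) ->
    (forall p : node d, (0 < size p < levels Q)%N ->
      (\rank (generator (row_compr (smash compr tau test_cost Q).1 p)) <= r)%N /\
      (\rank (generator (col_compr (smash compr tau test_cost Q).1 p)) <= r)%N) ->
    (forall p : node d, (0 < size p < levels Q)%N ->
      (#|bar compr Q (row_basis Q) p| <= r * 2 ^ d)%N /\
      (#|bar compr Q (col_basis Q) p| <= r * 2 ^ d)%N) ->
    ((smash compr tau test_cost Q).2 <= C * npts Q)%N.
Proof.
have [d0 _] := andP hd; have [tau0 _] := andP htau.
(* The factor [2 ^ d] comes from the bound on [bar]. *)
have [C0 costC0] := hcost (2 ^ d)%N.
have D0 : (0 < 2 ^ d)%N by rewrite expn_gt0.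
(* Cost of one node on one side: farfield entries, then the rank-revealing QR. *)
pose E := (r * 2 ^ d * r + C0 * r ^ 3)%N.
pose N := Num.bound (Num.sqrt d%:R / tau).
have N_ge : Num.sqrt d%:R / tau <= N%:R.
  by rewrite ltW // archi_boundP // divr_ge0 ?sqrtr_ge0 ?ltW.
pose W := (N.*2.+1.*2.+1 ^ d)%N.
(* Row and column compressions each give an [E], the tests give [W], and [c1] converts
   [(2 ^ d) ^ levels Q] into [npts Q]. *)
exists ((E + E + test_cost * W) * c1)%N => Q _ c1n _ hB _ hbar.
have node_cost (B : node d -> basis R K d) p : (bsize (B p) <= r)%N ->
    (#|bar compr Q B p| <= r * 2 ^ d)%N -> ((node_compr compr Q B p).2 <= E)%N.
  move=> Br barr; rewrite /node_compr /compress /=.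
  have := @costC0 r _ _ _ (farfield (bar compr Q B p) (B p)).1 hr.
  rewrite mulnC => /(_ barr) /=.
  case: (compr _ _ _ _) => c ops /= ops_le.
  rewrite leq_add ?leq_mul ?ops_le //.
  by rewrite (leq_trans Br) // leq_pmulr.
have rowE : (side_cost compr Q (row_basis Q) <= (2 ^ d) ^ levels Q * E)%N.
  apply: side_cost_le => // p hp.
  by apply: node_cost; [have [] := hB p hp | have [] := hbar p hp].
have colE : (side_cost compr Q (col_basis Q) <= (2 ^ d) ^ levels Q * E)%N.
  apply: side_cost_le => // p hp.
  by apply: node_cost; [have [] := hB p hp | have [] := hbar p hp].
have testW :
    (\sum_(0 <= l < levels Q) #|tested tau Q l| <= (2 ^ d) ^ levels Q * W)%N.
  apply: (@leq_trans (\sum_(0 <= l < levels Q) (2 ^ d) ^ l * W)).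
    by apply: leq_sum => l _; exact: card_tested.
  by rewrite -big_distrl leq_mul2r leq_sum_expn ?orbT // (leq_exp2l 1).
have DL : ((2 ^ d) ^ levels Q <= c1 * npts Q)%N.
  by rewrite -expnM; apply: leq_trans c1n; exact: leq_pmull.
apply: (@leq_trans ((2 ^ d) ^ levels Q * (E + E + test_cost * W))).
  rewrite /smash /= 2!mulnDr; apply: leq_add; first exact: leq_add.
  by rewrite mulnCA leq_mul2l testW orbT.
by rewrite -mulnA mulnC leq_mul2l DL orbT.
Qed.
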